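(* Let $a_1,\dots,a_k$ be positive integers with $\sum_{i=1}^k 1/a_i>1.546$. Then $(a_1,\dots,a_k)$ is good.
   Context: A tuple $(a_1,\dots,a_k)$ of positive integers is good if there are sets $S_1,\dots,S_k\subseteq\mathbb{R}$ such that any two distinct elements of $S_i$ differ by at least $a_i$ and every integer belongs to $S_1\cup\dots\cup S_k$; otherwise it is bad. *)

(* Defs.v *)
From mathcomp Require Import all_boot all_order all_algebra.
From mathcomp Require Import classical_sets reals.

Set Implicit Arguments.
Unset Strict Implicit.
Unset Printing Implicit Defensive.

Import Order.TTheory GRing.Theory Num.Theory.
Local Open Scope ring_scope.

Definition good (R : realType) (k : nat) (a : k.-tuple nat) : Prop :=
  exists S : 'I_k -> set R,
    (forall (i : 'I_k) (x y : R),
        S i x -> S i y -> x <> y -> (tnth a i)%:R <= `|x - y|) /\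
    (forall n : int, exists i : 'I_k, S i n%:~R).

(* Main.v *)
Require Import Defs.
From mathcomp Require Import all_boot all_order all_algebra.
From mathcomp Require Import classical_sets reals.
From mathcomp Require Import zify ring lra.

Set Implicit Arguments.
Unset Strict Implicit.
Unset Printing Implicit Defensive.

Import Order.TTheory GRing.Theory Num.Theory.
Local Open Scope ring_scope.

(** Fix an odd [c] and round every [a_i] up to the next number of the form
    [c * 2 ^ j].  Periods of this form can be packed greedily into residue
    classes, in increasing order, without waste; so the tuple is good as soon as
    the rounded densities add up to at least 1.  If some [a_i <= 2], then [c = 1]
    works, because rounding costs less than a factor 2 and nothing on [a_i].
    Otherwise all [a_i >= 3], and the rounded densities [w_c] satisfy
    [2/7 w_1 + 2/5 w_3 + 1/2 w_5 + 1/3 w_7 >= 1/a]; the coefficients add up to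
    [319/210 < 1.546], so one of [c = 1, 3, 5, 7] works. *)

(** The quotient is the ceiling of [a / c], so for positive [c] this is the least [j] with
    [a <= c * 2 ^ j]. *)
Definition dyadic_level (c a : nat) : nat := up_log 2 ((a + c.-1) %/ c).

Lemma leq_dyadic_level (c a : nat) :
  (0 < c)%N -> (a <= c * 2 ^ dyadic_level c a)%N.
Proof.
move=> c0; have := @up_logP 2 ((a + c.-1) %/ c) isT.
rewrite -/(dyadic_level c a) -ltnS ltn_divLR //.
by case: c c0 => // c _ /=; rewrite mulSn mulnC; lia.
Qed.

Lemma dyadic_level_min (c a j : nat) :
  (0 < c)%N -> (a <= c * 2 ^ j)%N -> (dyadic_level c a <= j)%N.
Proof.
move=> c0 le_a; apply: up_log_min => //.
rewrite -ltnS ltn_divLR //.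
by case: c c0 le_a => // c _ /=; rewrite !mulSn [(2 ^ j * _)%N]mulnC; lia.
Qed.

Section RoundedDensity.

Variable R : realFieldType.

Definition rounded_density (c a : nat) : R := ((c * 2 ^ dyadic_level c a)%:R)^-1.

Lemma rounded_density_ge (c a j : nat) :
  (0 < c)%N -> (a <= c * 2 ^ j)%N -> (c%:R * 2 ^+ j)^-1 <= rounded_density c a.
Proof.
move=> c0 le_a; rewrite -natrX -natrM /rounded_density.
rewrite lef_pV2 ?posrE ?ltr0n ?muln_gt0 ?c0 ?expn_gt0 // ler_nat.
by rewrite leq_pmul2l // leq_pexp2l // dyadic_level_min.
Qed.

Lemma rounded_density1_ge_half (a : nat) :
  (0 < a)%N -> (2 * a%:R)^-1 <= rounded_density 1 a.
Proof.
case: a => [//|[_|a _]].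
  by apply: le_trans (@rounded_density_ge 1 1 0 isT isT); rewrite expr0; lra.
have /andP[lt_a le_a] := @up_log_bounds 2 a.+2 isT isT.
apply: le_trans (@rounded_density_ge 1 a.+2 _ isT _); last by rewrite mul1n; exact: le_a.
set u := up_log 2 a.+2 in lt_a le_a *.
have u0 : (0 < u)%N by rewrite lt0n; apply: contraTneq le_a => ->.
rewrite mul1r lef_pV2 ?posrE ?exprn_gt0 ?mulr_gt0 ?ltr0n //.
by rewrite -(prednK u0) exprS ler_pM2l // -natrX ler_nat ltnW.
Qed.

Lemma rounded_density1_small (a : nat) :
  (0 < a <= 2)%N -> (a%:R)^-1 <= rounded_density 1 a.
Proof.
by case: a => [|[|[|a]]].
Qed.

(* The coefficients make the right-hand side equal to [1/(d * 2 ^ m)] on each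
   interval [d * 2 ^ m < a <= d.+1 * 2 ^ m], [4 <= d <= 7]. *)
Lemma rounded_density_average (a : nat) : (2 < a)%N ->
  (a%:R)^-1 <= 2 / 7 * rounded_density 1 a + 2 / 5 * rounded_density 3 a
             + 1 / 2 * rounded_density 5 a + 1 / 3 * rounded_density 7 a.
Proof.
move=> a2.
(* The scale [2 ^ m] used below needs [a > 4]; the values 3 and 4 are checked directly. *)
have [a4|a4] := leqP a 4.
  have := @rounded_density_ge 1 a 2 isT.
  have := @rounded_density_ge 5 a 0 isT.
  have := @rounded_density_ge 7 a 0 isT.
  have : a = 3%N \/ a = 4%N by lia.
  case=> ->.
    by have := @rounded_density_ge 3 3 0 isT isT => h /(_ isT) + /(_ isT) + /(_ isT); lra.
  by have := @rounded_density_ge 3 4 1 isT isT => h /(_ isT) + /(_ isT) + /(_ isT); lra.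
have /andP[lt_a le_a] := @up_log_bounds 2 a isT (ltnW a2).
have u3 : (2 < up_log 2 a)%N.
  rewrite ltnNge; apply/negP => u2.
  have : (2 ^ up_log 2 a <= 2 ^ 2)%N by rewrite leq_pexp2l.
  by rewrite leqNgt (leq_trans a4 le_a).
(* With [up_log 2 a = m + 3], [a] lies above [4 * 2 ^ m] and at most at [8 * 2 ^ m]. In this range
   the four roundings change only at 5, 6 and 7 times [2 ^ m]. *)
case: (up_log 2 a) u3 lt_a le_a => [|[|[|m]]] // _ /=.
rewrite !expnS => lt_a le_a.
pose X : R := (2 ^ m)%:R.
have X0 : 0 < X by rewrite ltr0n expn_gt0.
have a_gt (d : nat) : (0 < d)%N -> (d * 2 ^ m < a)%N -> (a%:R)^-1 <= d%:R^-1 * X^-1.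
  move=> d0 lt_da; rewrite -invfM -natrM lef_pV2 ?posrE ?ltr0n ?muln_gt0 ?d0 ?expn_gt0 //.
    by rewrite ler_nat ltnW.
  by lia.
have dens (c i : nat) : (0 < c)%N -> (a <= c * 2 ^ (i + m))%N ->
    c%:R^-1 * (2 ^+ i)^-1 * X^-1 <= rounded_density c a.
  move=> c0 /(rounded_density_ge c0); rewrite exprD -!natrX => h.
  by rewrite /X -!invfM -mulrA.
have Y0 : 0 < X^-1 by rewrite invr_gt0.
have h1 := dens 1%N 3%N isT; have h3 := dens 3%N 1%N isT.
have h3' := dens 3%N 2%N isT; have h5 := dens 5%N 0%N isT.
have h5' := dens 5%N 1%N isT; have h7 := dens 7%N 0%N isT.
have h7' := dens 7%N 1%N isT.
rewrite ?expnD ?expn1 in h1 h3 h3' h5 h5' h7 h7'.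
have {}h1 := h1 ltac:(lia).
have [a5|a5] := leqP a (5 * 2 ^ m).
  have := a_gt 4%N isT ltac:(lia).
  by move: (h3 ltac:(lia)) (h5 ltac:(lia)) (h7 ltac:(lia)) h1; lra.
have [a6|a6] := leqP a (6 * 2 ^ m).
  have := a_gt 5%N isT a5.
  by move: (h3 ltac:(lia)) (h5' ltac:(lia)) (h7 ltac:(lia)) h1; lra.
have [a7|a7] := leqP a (7 * 2 ^ m).
  have := a_gt 6%N isT a6.
  by move: (h3' ltac:(lia)) (h5' ltac:(lia)) (h7 ltac:(lia)) h1; lra.
have := a_gt 7%N isT a7.
by move: (h3' ltac:(lia)) (h5' ltac:(lia)) (h7' ltac:(lia)) h1; lra.
Qed.

End RoundedDensity.

Definition meets_residues (M : nat) (L : seq int) (n : int) : Prop :=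
  exists2 l, l \in L & (M %| n - l)%Z.

Lemma meets_residues_refine (M q : nat) (L : seq int) (n : int) : (0 < q)%N ->
  meets_residues M L n ->
  meets_residues (M * q) [seq l + (M * t)%:Z | l <- L, t <- iota 0 q] n.
Proof.
move=> q0 [l lL /dvdzP[x def_x]].
have q0z : q%:Z != 0 by rewrite eqz_nat -lt0n.
(* The class of [l] modulo [M] splits into [q] classes modulo [M * q]; the remainder of
   [x = (n - l) / M] modulo [q] selects the one containing [n]. *)
have [t def_t] : exists t : nat, (x %% q)%Z = t%:Z.
  by exists `|(x %% q)%Z|%N; rewrite gez0_abs // modz_ge0.
have lt_tq : (t < q)%N.
  by have := ltz_mod x q0z; rewrite def_t; lia.
exists (l + (M * t)%:Z).
  by apply/allpairsP; exists (l, t); split; rewrite //= mem_iota.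
apply/dvdzP; exists (x %/ q)%Z.
have /eqP := def_x; rewrite subr_eq => /eqP ->.
rewrite {1}(divz_eq x q) def_t !PoszM; ring.
Qed.

(* Greedy packing: while processing the periods in increasing order, the
   integers still to be covered form the residue classes [L] modulo
   [c * 2 ^ j]. *)
Lemma dyadic_packing (F : realFieldType) (T : eqType) (c : nat) (lev : T -> nat)
    (s : seq T) (j : nat) (L : seq int) :
  uniq s -> sorted (relpre lev leq) s -> all (fun x => j <= lev x)%N s ->
  (size L)%:R / 2 ^+ j <= \sum_(x <- s) (2 ^+ lev x)^-1 :> F ->
  exists r : T -> int, forall n : int, meets_residues (c * 2 ^ j) L n ->
    exists2 x, x \in s & ((c * 2 ^ lev x)%:Z %| n - r x)%Z.
Proof.
elim: s j L => [|x s IH] j L /=.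
  (* With no period left, the density hypothesis forces [L] to be empty. *)
  move=> _ _ _; rewrite big_nil pmulr_lle0 ?invr_gt0 ?exprn_gt0 //.
  rewrite lern0 size_eq0 => /eqP ->.
  by exists (fun=> 0) => n [].
move=> /andP[xs uniq_s] sorted_s /andP[le_jx _].
rewrite big_cons => le_sum.
have le_xs : all (fun y => lev x <= lev y)%N s.
  by apply: (order_path_min _ sorted_s) => y z t /=; exact: leq_trans.
pose q := (2 ^ (lev x - j))%N.
have q0 : (0 < q)%N by rewrite expn_gt0.
have def_q : (c * 2 ^ j * q = c * 2 ^ lev x)%N by rewrite -mulnA -expnD subnKC.
(* The uncovered set is rewritten modulo the period of [x]. Then [x] takes the first class [r0], and
   [L''] is left to the later periods. *)
pose L' := [seq l + (c * 2 ^ j * t)%:Z | l <- L, t <- iota 0 q].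
have sizeL' : size L' = (size L * q)%N by rewrite size_allpairs size_iota.
have refine n : meets_residues (c * 2 ^ j) L n -> meets_residues (c * 2 ^ lev x) L' n.
  by move=> /(meets_residues_refine q0); rewrite def_q.
have [L'0|[r0 [L'' defL']]] : L' = [::] \/ exists r0 L'', L' = r0 :: L''.
  by case: L' {sizeL' refine} => [|r0 L'']; [left|right; exists r0, L''].
  by exists (fun=> 0) => n /refine; rewrite L'0 => -[].
have [|r rP] := IH (lev x) L'' uniq_s (path_sorted sorted_s) le_xs.
  (* Refining preserves density, and removing [r0] lowers both sides of the hypothesis by exactly
     [1 / 2 ^ lev x]. *)
  have : (size L')%:R / 2 ^+ lev x = (size L)%:R / 2 ^+ j :> F.
    rewrite sizeL' natrM natrX -{2}(subnKC le_jx) exprD; field.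
    by rewrite !expf_neq0 // pnatr_eq0.
  rewrite defL' /= => def_size; move: le_sum; rewrite -def_size -natr1 mulrDl mul1r.
  by rewrite addrC lerD2l.
exists (fun y => if y == x then r0 else r y) => n /refine.
rewrite defL' => -[l]; rewrite inE => /orP[/eqP -> dvd_n|lL'' dvd_n].
  by exists x; rewrite ?mem_head ?eqxx.
have [|y ys dvd_y] := rP n; first by exists l.
exists y; first by rewrite inE ys orbT.
by case: eqP => // eq_yx; rewrite -eq_yx ys in xs.
Qed.

(** Take for [S i] the integers congruent to [r i] modulo [M i]: distinct ones differ by a nonzero
    multiple of [M i]. *)
Lemma good_of_residue_cover (R : realType) (k : nat) (a : k.-tuple nat)
    (M : 'I_k -> nat) (r : 'I_k -> int) :
  (forall i, tnth a i <= M i)%N ->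
  (forall n : int, exists i, (M i %| n - r i)%Z) -> good R a.
Proof.
move=> le_aM cover.
exists (fun i x => exists2 n : int, x = n%:~R & (M i %| n - r i)%Z); split; last first.
  by move=> n; have [i dvd_i] := cover n; exists i, n.
move=> i _ _ [m -> dvd_m] [n -> dvd_n] neq_mn.
have dvd_mn : (M i %| m - n)%Z.
  rewrite (_ : m - n = (m - r i) - (n - r i)); last by ring.
  exact: rpredB.
rewrite -intrB -intr_norm -[X in X <= _]/((Posz (tnth a i))%:~R) ler_int.
apply: (@le_trans _ _ (M i)%:Z); first by rewrite lez_nat le_aM.
rewrite -abszE lez_nat; apply: dvdn_leq => //.
by rewrite absz_gt0 subr_eq0; apply: contra_not_neq neq_mn => ->.
Qed.

Lemma good_of_rounded_density (R : realType) (k : nat) (a : k.-tuple nat) (c : nat) :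
  (0 < c)%N -> 1 <= \sum_(i < k) rounded_density R c (tnth a i) -> good R a.
Proof.
move=> c0 sum_ge1.
pose lev (i : 'I_k) := dyadic_level c (tnth a i).
pose s := sort (relpre lev leq) (enum 'I_k).
have lev_total : total (relpre lev leq) by move=> i j; exact: leq_total.
(* Packing starts with all [c] classes modulo [c] uncovered, so the density hypothesis is [sum_ge1]
   multiplied by [c]. *)
have [||||r rP] := @dyadic_packing R 'I_k c lev s 0 [seq t%:Z | t <- iota 0 c].
- by rewrite sort_uniq enum_uniq.
- exact: sort_sorted.
- exact/allP.
- rewrite size_map size_iota expr0 divr1 (perm_big (enum 'I_k)); last by rewrite perm_sort.
  rewrite big_enum /= -[X in X <= _]mulr1.
  rewrite -ler_pdivlMl ?ltr0n // mulr_sumr.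
  apply: le_trans sum_ge1 _; apply: ler_sum => i _.
  by rewrite /rounded_density natrM natrX invfM.
apply: (@good_of_residue_cover R k a (fun i => c * 2 ^ lev i)%N r).
  by move=> i; exact: leq_dyadic_level.
move=> n; have [|i _ dvd_i] := rP n; last by exists i.
have c0z : c%:Z != 0 by rewrite eqz_nat -lt0n.
exists (n %% c)%Z; last first.
  by rewrite expn0 muln1 {1}(divz_eq n c) addrK dvdz_mull.
apply/mapP; exists `|(n %% c)%Z|%N; last by rewrite gez0_abs // modz_ge0.
rewrite mem_iota /= add0n -ltz_nat gez0_abs ?modz_ge0 //.
by have := ltz_mod n c0z.
Qed.

Theorem theorem7 (R : realType) (k : nat) (a : k.-tuple nat)
    (a_pos : forall i : 'I_k, (0 < tnth a i)%N)
    (a_sum : 1546%:R / 1000%:R < \sum_(i < k) ((tnth a i)%:R)^-1 :> R) :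
  good R a.
Proof.
pose W c : R := \sum_(i < k) rounded_density R c (tnth a i).
have goodW c : (0 < c)%N -> 1 <= W c -> good R a by exact: good_of_rounded_density.
have [/existsP[i0 a_i0]|a_ge3] := boolP [exists i, tnth a i <= 2]%N.
  apply: (goodW 1%N) => //; rewrite /W (bigD1 i0) //=.
  move: a_sum; rewrite (bigD1 i0) //=.
  set D := \sum_(i < k | i != i0) _; set W0 := \sum_(i < k | i != i0) _ => a_sum.
  (* Only the terms other than [i0] may lose a factor 2, so [W 1] is at least half the full sum plus
     half of [1 / a_i0], which exceeds [0.773 + 0.25]. *)
  have DW : 2^-1 * D <= W0.
    rewrite mulr_sumr; apply: ler_sum => i _.
    by rewrite -invfM rounded_density1_ge_half.
  have := @rounded_density1_small R (tnth a i0); rewrite a_pos a_i0 => /(_ isT).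
  have : (2 : R)^-1 <= (tnth a i0)%:R^-1.
    by rewrite lef_pV2 ?posrE ?ltr0n // ler_nat.
  by move: DW a_sum; lra.
have le_sum : \sum_(i < k) ((tnth a i)%:R)^-1
    <= 2 / 7 * W 1%N + 2 / 5 * W 3%N + 1 / 2 * W 5%N + 1 / 3 * W 7%N.
  rewrite !mulr_sumr -!big_split /=; apply: ler_sum => i _.
  apply: rounded_density_average; rewrite ltnNge.
  by move: a_ge3; rewrite negb_exists => /forallP.
have [|W1] := leP 1 (W 1%N); first exact: goodW.
have [|W3] := leP 1 (W 3%N); first exact: goodW.
have [|W5] := leP 1 (W 5%N); first exact: goodW.
have [|W7] := leP 1 (W 7%N); first exact: goodW.
by move: a_sum le_sum W1 W3 W5 W7; lra.
Qed.
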